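(* Let $(X,d)$ be a nonempty metric space, and let $k\geq 2$ be an integer. The following are equivalent. (1) There exists a nonempty metric space $(P,d_P)$ such that $(X,d)$ is isometric (via a bijective isometry) to $P^k$ with the metric $d_{P^k}(p,q)=\max_{1\leq j\leq k}d_P(p_j,q_j)$. (2) There exist equivalence relations $E_1,\dots,E_k$ on $X$ such that: (a) the quotient distance $\bar d_{E_j}$ is a metric on $X/E_j$ for each $j$; (b) for every choice of classes $C_j\in X/E_j$, $1\leq j\leq k$, the intersection $\bigcap_{j=1}^kC_j$ consists of exactly one point; (c) for all $x,y\in X$, $d(x,y)=\max_{1\leq j\leq k}\bar d_{E_j}([x]_{E_j},[y]_{E_j})$; (d) there exists a metric space $(P,d_P)$ such that each $(X/E_j,\bar d_{E_j})$ is isometric to $(P,d_P)$.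
   Context: For an equivalence relation $E$ on a metric space $(X,d)$, $[x]_E$ is the $E$-class of $x$, and $\bar d_E([x]_E,[y]_E):=\inf\{d(x',y'):x'\,E\,x,\ y'\,E\,y\}$ is the quotient distance on $X/E$. All metric spaces are nonempty, and ''isometric'' means related by a bijective isometry. *)

(* Defs.v *)
From HB Require Import structures.
From mathcomp Require Import all_boot all_order all_algebra generic_quotient.
From mathcomp Require Import all_classical all_reals topology.

Set Implicit Arguments.
Unset Strict Implicit.
Unset Printing Implicit Defensive.

Import Order.TTheory GRing.Theory Num.Theory.

Local Open Scope classical_set_scope.
Local Open Scope ring_scope.
Local Open Scope quotient_scope.

Definition is_metric (R : realType) (T : Type) (d : T -> T -> R) : Prop :=
  [/\ forall x y, 0 <= d x y,
      forall x y, d x y = 0 <-> x = y,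
      forall x y, d x y = d y x &
      forall x y z, d x z <= d x y + d y z].

Definition isometric (R : realType) (T U : Type)
    (dT : T -> T -> R) (dU : U -> U -> R) : Prop :=
  exists2 f : T -> U, bijective f & forall x y, dU (f x) (f y) = dT x y.

(* The maximum has seed 0: this is the usual maximum of a nonempty finite
   family as soon as its members are nonnegative, as distances are. *)
Definition max_dist (R : realType) (k : nat) (P : metricType R)
    (p q : 'I_k -> P) : R :=
  \big[Num.max/0]_(j < k) mdist (p j) (q j).

Section Quotient.
Context {R : realType} {X : metricType R} (E : equiv_rel X).

(* The points of the equivalence class that an element of X/E stands for *)
Definition eclass (C : {eq_quot E}) : set X :=
  [set x | \pi_{eq_quot E} x = C].

Definition quot_dist (C D : {eq_quot E}) : R :=
  inf [set mdist x y | x in eclass C & y in eclass D].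

Lemma eclassE (x y : X) : eclass (\pi_{eq_quot E} x) y <-> E x y.
Proof.
rewrite /eclass /=; split => [/esym/eqP|Exy]; first by rewrite eqmodE.
by apply/esym/eqP; rewrite eqmodE.
Qed.

(* In particular the seed 0 is harmless in a maximum of quotient distances. *)
Lemma quot_dist_ge0 (C D : {eq_quot E}) : 0 <= quot_dist C D.
Proof.
apply: lb_le_inf.
  exists (mdist (repr C) (repr D)); exists (repr C); first exact: reprK.
  by exists (repr D); first exact: reprK.
by move=> _ [x _ [y _ <-]]; exact: mdist_ge0.
Qed.

End Quotient.

(* Main.v *)
Require Import Defs.
From HB Require Import structures.
From mathcomp Require Import all_boot all_order all_algebra generic_quotient.
From mathcomp Require Import all_classical all_reals topology.

(** An isometry [g] from [X] onto the power [P^k] and a family [E_1, ..., E_k]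
of equivalence relations carry the same information: [E_j] is the kernel of the
[j]-th coordinate of [g], and conversely [g x] lists the classes of
[x], seen as points of [P].

From a power to relations, the point is that the quotient distance of [E_j] is
the distance of [P].  Each coordinate of [g] is 1-Lipschitz because the metric
of [P^k] is a maximum, so distances between classes are at least those in [P].
They are attained: from a point [x], changing only its [j]-th coordinate to [p]
moves [x] by exactly [d_P(x_j, p)].  So each coordinate is a 1-Lipschitz map
that lifts distances exactly ([mdist_coord_le], [mdist_coord_lift]), and any
such map induces an isometry from the quotient by its kernel onto its target
([quot_dist_ker]).  The quotients are thereby metric spaces isometric to [P],
a choice of classes is a point of [P^k], which is met once because [g] is
bijective, and the formula for the distance of [X] says that [g] is isometric.

From relations to a power, the bijections of the quotients with [P] turn the
map sending [x] to its classes into a map to [P^k]; it is bijective because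
each family of classes meets in one point, and isometric because the distance
of [X] is the maximum of the quotient distances. *)

Import Order.TTheory GRing.Theory Num.Theory.

Local Open Scope classical_set_scope.
Local Open Scope ring_scope.
Local Open Scope quotient_scope.

Definition ker_rel {T : Type} {U : eqType} (f : T -> U) : equiv_rel T :=
  EquivRel (fun x y => f x == f y) (fun x => eqxx (f x))
    (fun x y => eq_sym (f x) (f y))
    (fun y x z xy yz => etrans (congr1 (eq_op^~ (f z)) (eqP xy)) yz).

(** The map from the quotient by the kernel of [f] through which [f] factors. *)
Definition ker_val {T : choiceType} {U : eqType} (f : T -> U)
  (C : {eq_quot (ker_rel f)}) : U := f (repr C).

Lemma ker_val_pi {T : choiceType} {U : eqType} (f : T -> U) (x : T) :
  ker_val f (\pi_{eq_quot (ker_rel f)} x) = f x.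
Proof. by apply/eqP; rewrite -[_ == _]/(ker_rel f _ _) -eqmodE reprK. Qed.

Lemma ker_val_inj {T : choiceType} {U : eqType} (f : T -> U) :
  injective (ker_val f).
Proof.
move=> C D CD; rewrite -[C]reprK -[D]reprK.
by apply/eqmodP/eqP.
Qed.

Lemma eclass_ker {R : realType} {X : metricType R} {U : eqType} (f : X -> U)
    (C : {eq_quot (ker_rel f)}) (x : X) :
  eclass C x <-> f x = ker_val f C.
Proof.
rewrite /eclass /=; split => [<-|fx]; first by rewrite ker_val_pi.
by apply: (@ker_val_inj _ _ f); rewrite ker_val_pi.
Qed.

(** The infimum defining the quotient distance is a minimum: [hle] bounds every
distance between two classes from below, and [hlift], applied to a point of the
first class, provides a point of the second class reaching the bound. *)
Lemma quot_dist_ker {R : realType} {X P : metricType R} (f : X -> P)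
    (hle : forall x y, mdist (f x) (f y) <= mdist x y)
    (hlift : forall x p, exists2 y, f y = p & mdist x y = mdist (f x) p)
    (C D : {eq_quot (ker_rel f)}) :
  quot_dist C D = mdist (ker_val f C) (ker_val f D).
Proof.
have lb : lbound [set mdist x y | x in eclass C & y in eclass D]
    (mdist (ker_val f C) (ker_val f D)).
  by move=> _ [x /eclass_ker <- [y /eclass_ker <- <-]]; exact: hle.
have [y fy dy] := hlift (repr C) (ker_val f D).
have at_min : [set mdist x y | x in eclass C & y in eclass D]
    (mdist (ker_val f C) (ker_val f D)).
  exists (repr C); first exact/eclass_ker.
  by exists y => //; exact/eclass_ker.
apply/eqP; rewrite eq_le; apply/andP; split.
- by apply: ge_inf => //; exists (mdist (ker_val f C) (ker_val f D)).
- by apply: lb_le_inf => //; exists (mdist (ker_val f C) (ker_val f D)).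
Qed.

Lemma ker_val_bij {T : choiceType} {U : eqType} (f : T -> U)
    (hsurj : forall p, exists x, f x = p) :
  bijective (ker_val f).
Proof.
rewrite -setTT_bijective; split => //; first by move=> C D _ _ /ker_val_inj.
by move=> p _; have [x <-] := hsurj p; exists (\pi x) => //; exact: ker_val_pi.
Qed.

Lemma is_metric_mdist {R : realType} (P : metricType R) :
  is_metric (@mdist R P).
Proof.
split; [exact: mdist_ge0| |exact: metric_sym|].
  by move=> x y; split => [/mdist_positivity|->]; last exact: mdistxx.
by move=> x y z; exact: metric_triangle.
Qed.

Lemma is_metric_isometric {R : realType} {T U : Type}
    (dT : T -> T -> R) (dU : U -> U -> R) :
  isometric dT dU -> is_metric dU -> is_metric dT.
Proof.
move=> [f /bij_inj finj fd] [d0 dE dC dD]; split.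
- by move=> x y; rewrite -fd.
- by move=> x y; rewrite -fd; split => [/dE/finj|->] //; apply/dE.
- by move=> x y; rewrite -!fd.
- by move=> x y z; rewrite -!fd.
Qed.

Lemma mdist_coord_le {R : realType} {X P : metricType R} {k : nat}
    (g : X -> 'I_k -> P) (gd : forall x y, max_dist (g x) (g y) = mdist x y)
    (j : 'I_k) (x y : X) :
  mdist (g x j) (g y j) <= mdist x y.
Proof.
by rewrite -gd; apply: (le_bigmax _ (fun j => mdist (g x j) (g y j))).
Qed.

(** The lift of [p] is the point with the coordinates of [x], except that the
[j]-th one is [p]: the other coordinates contribute 0 to the maximum. *)
Lemma mdist_coord_lift {R : realType} {X P : metricType R} {k : nat}
    (g : X -> 'I_k -> P) (gd : forall x y, max_dist (g x) (g y) = mdist x y)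
    (gbij : bijective g) (j : 'I_k) (x : X) (p : P) :
  exists2 y, g y j = p & mdist x y = mdist (g x j) p.
Proof.
have [h _ hK] := gbij.
pose q i := if i == j then p else g x i.
have gq : g (h q) j = p by rewrite hK /q eqxx.
exists (h q) => //; apply/eqP; rewrite eq_le; apply/andP; split.
- rewrite -gd hK; apply: bigmax_le => [|i _]; first exact: mdist_ge0.
  rewrite /q; case: eqP => [->//|_].
  by rewrite mdistxx; exact: mdist_ge0.
- by rewrite -{1}gq; exact: mdist_coord_le.
Qed.

Theorem corollary3p14 (R : realType) (X : metricType R) (k : nat)
    (hX : [set: X] !=set0) (hk : (2 <= k)%N) :
  (exists P : metricType R,
     [set: P] !=set0 /\
     isometric (@mdist R X) (@max_dist R k P))
  <->
  (exists E : 'I_k -> equiv_rel X,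
     [/\ (forall j : 'I_k, is_metric (@quot_dist R X (E j))),
         (forall C : forall j : 'I_k, {eq_quot (E j)},
            exists x : X, \bigcap_(j in [set: 'I_k]) eclass (C j) = [set x]),
         (forall x y : X,
            mdist x y =
            \big[Num.max/0]_(j < k)
              quot_dist (\pi_{eq_quot (E j)} x) (\pi_{eq_quot (E j)} y)) &
         (exists P : metricType R,
            [set: P] !=set0 /\
            forall j : 'I_k,
              isometric (@quot_dist R X (E j)) (@mdist R P))]).
Proof.
split.
- move=> [P [_ [g gbij gd]]]; exists (fun j => ker_rel (g^~ j)).
  have quotE j := quot_dist_ker (g^~ j) (mdist_coord_le g gd j)
    (mdist_coord_lift g gd gbij j).
  have iso j : isometric (@quot_dist R X (ker_rel (g^~ j))) (@mdist R P).
    exists (ker_val (g^~ j)) => [|C D]; last by rewrite quotE.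
    apply: ker_val_bij => p; have [x0 _] := hX.
    by have [y yp _] := mdist_coord_lift g gd gbij j x0 p; exists y.
  split.
  + by move=> j; exact: is_metric_isometric (iso j) (is_metric_mdist P).
  + move=> C; have [h gK hK] := gbij; exists (h (fun j => ker_val _ (C j))).
    apply/seteqP; split => [x xC|_ -> j _].
      rewrite -(gK x) /=; congr (h _); apply/funext => j.
      exact/(eclass_ker (g^~ j))/xC.
    by apply/(eclass_ker (g^~ j)); rewrite /= hK.
  + move=> x y; rewrite -gd; apply: eq_bigr => j _.
    by rewrite quotE !(ker_val_pi (g^~ j)).
  + exists P; split => //; have [x0 _] := hX.
    by exists (g x0 (Ordinal (ltnW hk))).
- move=> [E [_ hcap hd [P [P0 hiso]]]]; exists P; split => //.
  pose f j := sval (cid2 (hiso j)).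
  have fbij j : bijective (f j) by rewrite /f; case: cid2.
  have fd j C D : mdist (f j C) (f j D) = quot_dist C D.
    by rewrite /f; case: cid2.
  exists (fun x j => f j (\pi_{eq_quot (E j)} x)).
    rewrite -setTT_bijective; split => //.
    * move=> x y _ _ fxy.
      have [z zE] := hcap (fun j => \pi_{eq_quot (E j)} x).
      have xz : [set z] x by rewrite -zE => j _.
      have yz : [set z] y.
        rewrite -zE => j _; rewrite /eclass /=.
        by apply: (bij_inj (fbij j)); exact/esym/(congr1 (@^~ j) fxy).
      by rewrite xz yz.
    * move=> p _.
      have finv j : exists C, f j C = p j.
        by have [h _ hK] := fbij j; exists (h (p j)).
      have [z zE] := hcap (fun j => sval (cid (finv j))).
      have : [set z] z by [].
      rewrite -zE => zC.
      exists z => //; apply/funext => j.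
      by rewrite (zC j I); case: cid.
  by move=> x y; rewrite hd; apply: eq_bigr => j _; exact: fd.
Qed.
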